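(* Let $E$ be a Banach space. If $X$ is a closed subspace of $E$ and $Z$ is a closed subspace of $E^*$, then the following conditions are equivalent: (a) $\overline{Z}^{w^*}$ is norming for $X$. (b) The restriction to $X$ of the quotient map $Q: E\to E/Z_{\perp}$ is an isomorphic embedding. (c) $Z$ is total over $X$ and the (direct) sum $X\oplus Z_{\perp}$ is closed in $E$. If, in addition, $B_Z$ is $w^*$-dense in $B_{\overline{Z}^{w^*}}$, then these conditions are equivalent to: (d) $Z$ is norming for $X$.
   Context: $E^*$ is the dual of the Banach space $E$, $w^*$ denotes the weak-star topology $\sigma(E^*,E)$ on $E^*$, and $\overline{Z}^{w^*}$ is the $w^*$-closure of $Z$ in $E^*$. $B_Y$ denotes the unit ball of a normed space $Y$. For a subspace $X\subset E$ and a subspace $Z\subset E^*$: - $Z_{\perp} = \{x\in E : f(x)=0 \text{ for every } f\in Z\}$. - $Z$ is norming for $X$ if the formula $|||x||| = \sup_{f\in B_Z}|f(x)|$, $x\in X$, defines an equivalent norm on $X$. - $Z$ is total over $X$ if $X\cap Z_{\perp}=\{0\}$ (so that the sum $X+Z_{\perp}$ is direct, and is denoted $X\oplus Z_{\perp}$). An isomorphic embedding is a bounded linear map that is an isomorphism (linear homeomorphism) onto its range. *)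

(* Defs.v *)
From HB Require Import structures.
From mathcomp Require Import all_boot all_order all_algebra.
From mathcomp Require Import generic_quotient ring_quotient complex.
From mathcomp Require Import boolp classical_sets functions reals topology.
From mathcomp Require Import normedtype.

Set Implicit Arguments.
Unset Strict Implicit.
Unset Printing Implicit Defensive.

Import Order.TTheory GRing.Theory Num.Theory.
Import numFieldNormedType.Exports.

Local Open Scope classical_set_scope.
Local Open Scope ring_scope.

(* The scalar fields R and C treated uniformly: the real elements of K are
   conditionally complete, and K is either real or of the form R + iR with the
   Euclidean modulus.  Norms over K are K-valued, with real values, and suprema
   of real sets are taken for the (partial) order of K. *)
HB.mixin Record NumField_isRC K of Num.NumField K := {
  rc_lub : forall A : set K, A `<=` [set` Num.real] ->
    A !=set0 -> has_ubound A -> supremums A !=set0 ;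
  rc_real_or_complex : (forall x : K, x \is Num.real) \/
    (exists i : K, i ^+ 2 = -1 /\
      forall z : K, exists x y : K, [/\ x \is Num.real, y \is Num.real,
        z = x + i * y & `|z| ^+ 2 = x ^+ 2 + y ^+ 2])
}.

#[short(type="rcFieldType")]
HB.structure Definition RCField :=
  {K of Num.NumField K & NumField_isRC K}.

Section RealInstance.
Variable R : realType.

Lemma real_rc_lub (A : set R) : A `<=` [set` Num.real] ->
  A !=set0 -> has_ubound A -> supremums A !=set0.
Proof.
move=> _ A0 Aub; exists (sup A); split; first exact: sup_upper_bound.
by move=> x Ax; exact: ge_sup.
Qed.

Lemma real_rc : (forall x : R, x \is Num.real) \/
    (exists i : R, i ^+ 2 = -1 /\
      forall z : R, exists x y : R, [/\ x \is Num.real, y \is Num.real,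
        z = x + i * y & `|z| ^+ 2 = x ^+ 2 + y ^+ 2]).
Proof. by left=> x; exact: num_real. Qed.

(* The mixin is purely propositional, so no conflicting data is introduced. *)
#[non_forgetful_inheritance]
HB.instance Definition _ := NumField_isRC.Build R real_rc_lub real_rc.

End RealInstance.

Section ComplexInstance.
Variable R : realType.
Local Notation C := (complex R).
Local Open Scope complex_scope.

Lemma complex_rc_lub (A : set C) : A `<=` [set` Num.real] ->
  A !=set0 -> has_ubound A -> supremums A !=set0.
Proof.
move=> Ar [a Aa] [b Ab].
have AE x : A x -> x = (complex.Re x)%:C by move=> /Ar/RRe_real.
have Bs : has_sup (@complex.Re R @` A).
  split; first by exists (complex.Re a), a.
  by exists (complex.Re b) => _ [x Ax <-]; move: (Ab x Ax); rewrite lecE => /andP[].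
exists (sup (@complex.Re R @` A))%:C; split.
  move=> x Ax; rewrite (AE x Ax) lecR.
  by apply: sup_upper_bound => //; exists x.
move=> y yub; rewrite lecE /=.
have := yub a Aa; rewrite (AE a Aa) lecE /= => /andP[-> _] /=.
apply: ge_sup; first by case: Bs.
by move=> _ [x Ax <-]; move: (yub x Ax); rewrite lecE => /andP[].
Qed.

Lemma complex_rc : (forall x : C, x \is Num.real) \/
    (exists i : C, i ^+ 2 = -1 /\
      forall z : C, exists x y : C, [/\ x \is Num.real, y \is Num.real,
        z = x + i * y & `|z| ^+ 2 = x ^+ 2 + y ^+ 2]).
Proof.
right; exists 'i; split; first exact: sqr_i.
move=> z; exists (complex.Re z)%:C, (complex.Im z)%:C.
split; rewrite ?complex_real //; first exact: complexE.
by rewrite -add_Re2_Im2 rmorphD !rmorphXn.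
Qed.

HB.instance Definition _ := NumField_isRC.Build C complex_rc_lub complex_rc.

End ComplexInstance.

Section RCFieldTheory.
Variable K : rcFieldType.

Lemma supremumP (A : set K) (x0 : K) : A `<=` [set` Num.real] ->
  A !=set0 -> has_ubound A -> supremums A (supremum x0 A).
Proof.
move=> Ar A0 Aub; have [s sA] := rc_lub _ Ar A0 Aub.
rewrite /supremum; case: ifPn => [/eqP A00|_]; first by case: A0; rewrite A00.
by case: xgetP => // /(_ s).
Qed.

Lemma infimumP (A : set K) (x0 : K) : A `<=` [set` Num.real] ->
  A !=set0 -> has_lbound A -> infimums A (infimum x0 A).
Proof.
move=> Ar A0 [b Ab].
pose B := [set - x | x in A].
have [|||s [Bs sB]] := @rc_lub K B.
- by move=> _ [x Ax <-]; rewrite /= realN; exact: Ar.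
- by case: A0 => a Aa; exists (- a), a.
- by exists (- b) => _ [x Ax <-]; rewrite lerN2; exact: Ab.
have iA : infimums A (- s).
  split=> [x Ax|y Ay]; first by rewrite lerNl; apply: Bs; exists x.
  by rewrite lerNr; apply: sB => _ [x Ax <-]; rewrite lerN2; exact: Ay.
rewrite /infimum; case: ifPn => [/eqP A00|_]; first by case: A0; rewrite A00.
by case: xgetP => // /(_ (- s)).
Qed.

End RCFieldTheory.

Record closedSubspace (K : numFieldType) (V : normedModType K) := ClosedSubspace {
  closed_subspace_set :> set V ;
  closed_subspace_submod : GRing.submod_closed [in closed_subspace_set] ;
  closed_subspace_closed : closed closed_subspace_set
}.

Section Dual.
Variables (K : rcFieldType) (E : normedModType K).

Definition functional_pred : {pred E -> K^o} :=
  fun f => `[< linear f /\ continuous f >].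

Lemma functional_submod_closed : GRing.submod_closed functional_pred.
Proof.
split.
  apply/asboolP; split; last exact: cst_continuous.
  by move=> a x y; rewrite scaler0 addr0.
move=> a f g /asboolP[lf cf] /asboolP[lg cg]; apply/asboolP; split.
  move=> b x y; rewrite !fctE lf lg !scalerDr !scalerA mulrC -!addrA.
  by congr (_ + _); rewrite addrCA.
move=> x; apply: cvgD; last exact: cg.
by apply: cvgZr; exact: cf.
Qed.

HB.instance Definition _ :=
  GRing.isSubmodClosed.Build _ _ functional_pred functional_submod_closed.

Record dual := Dual {
  dual_fun :> E -> K^o ;
  dual_funP : dual_fun \in functional_pred
}.

HB.instance Definition _ := [isSub for dual_fun].
HB.instance Definition _ := [Choice of dual by <:].
HB.instance Definition _ := [SubChoice_isSubLmodule of dual by <:].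

Lemma dual_linear (f : dual) : linear f.
Proof. by have /asboolP[] := dual_funP f. Qed.

Lemma dual_continuous (f : dual) : continuous f.
Proof. by have /asboolP[] := dual_funP f. Qed.

HB.instance Definition _ (f : dual) :=
  GRing.isLinear.Build K E K^o *:%R f (dual_linear f).

Definition dual_norm (f : dual) : K :=
  supremum 0 [set `|f x| | x in [set x | `|x| <= 1]].

Lemma dual_normP (f : dual) :
  supremums [set `|f x| | x in [set x | `|x| <= 1]] (dual_norm f).
Proof.
apply: supremumP.
- by move=> _ [x _ <-]; exact: normr_real.
- by exists `|f 0|, 0 => //=; rewrite normr0.
have /continuous_linear_bounded/linear_boundedP : {for 0, continuous f}.
  exact: dual_continuous.
move=> /pinfty_ex_gt0[r r0 fr]; exists r => _ [x /= x1 <-].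
by rewrite (le_trans (fr x))// ler_piMr// ltW.
Qed.

Lemma dual_norm_ge (f : dual) (x : E) : `|f x| <= dual_norm f * `|x|.
Proof.
have [->|x0] := eqVneq x 0; first by rewrite linear0 !normr0 mulr0.
have nx : `|x| != 0 by rewrite normr_eq0.
rewrite -ler_pdivrMr ?normr_gt0//.
have [ub _] := dual_normP f; apply: ub; exists (`|x|^-1 *: x).
  by rewrite /= normrZ normfV normr_id mulVf.
by rewrite linearZ normrZ normfV normr_id mulrC.
Qed.

Lemma dual_norm_le (f : dual) (M : K) :
  (forall x, `|x| <= 1 -> `|f x| <= M) -> dual_norm f <= M.
Proof.
by move=> fM; have [_ lub] := dual_normP f; apply: lub => _ [x x1 <-]; exact: fM.
Qed.

Lemma dual_norm_ge0 (f : dual) : 0 <= dual_norm f.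
Proof.
have [ub _] := dual_normP f; apply: (le_trans (normr_ge0 (f 0))).
by apply: ub; exists 0 => //=; rewrite normr0.
Qed.

Lemma dual_normD (f g : dual) : dual_norm (f + g) <= dual_norm f + dual_norm g.
Proof.
apply: dual_norm_le => x x1; rewrite (le_trans (ler_normD _ _))//.
by rewrite lerD// (le_trans (dual_norm_ge _ _))// ler_piMr// dual_norm_ge0.
Qed.

Lemma dual_normZ (a : K) (f : dual) : dual_norm (a *: f) = `|a| * dual_norm f.
Proof.
have leZ b (g : dual) : dual_norm (b *: g) <= `|b| * dual_norm g.
  apply: dual_norm_le => x x1.
  rewrite [X in `|X|](_ : _ = b *: g x)// normrZ ler_wpM2l//.
  by rewrite (le_trans (dual_norm_ge _ _))// ler_piMr// dual_norm_ge0.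
apply/eqP; rewrite eq_le leZ /=.
have [->|a0] := eqVneq a 0; first by rewrite normr0 mul0r dual_norm_ge0.
rewrite -ler_pdivlMl ?normr_gt0// -normfV.
by have := leZ a^-1 (a *: f); rewrite scalerA mulVf// scale1r.
Qed.

Lemma dual_norm0_eq0 (f : dual) : dual_norm f = 0 -> f = 0.
Proof.
move=> f0; apply/val_inj/funext => x; apply/eqP; rewrite -normr_le0.
by rewrite (le_trans (dual_norm_ge f x))// f0 mul0r.
Qed.

HB.instance Definition _ :=
  Lmodule_isNormed.Build K dual dual_normD dual_normZ dual_norm0_eq0.

(* A copy of the dual carrying sigma(E^*, E), the topology induced by pointwise
   convergence on E; [dual] itself carries the operator norm topology. *)
Definition weak_star : Type :=
  initial_topology (fun f : dual => (f : E -> K^o) : {ptws E -> K^o}).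

HB.instance Definition _ := Topological.on weak_star.

Definition weak_star_closure (Z : set dual) : set dual :=
  closure (Z : set weak_star).

Definition ball_in (V : normedModType K) (A : set V) : set V :=
  A `&` [set v | `|v| <= 1].

Definition pre_annihilator (Z : set dual) : set E :=
  [set x | forall f, Z f -> f x = 0].

Lemma pre_annihilator_submod (Z : set dual) :
  GRing.submod_closed [in pre_annihilator Z].
Proof.
split; first by rewrite inE => f _; exact: linear0.
move=> a x y; rewrite !inE => xZ yZ f Zf.
by rewrite linearP /= xZ// yZ// scaler0 addr0.
Qed.

Lemma pre_annihilator_closed (Z : set dual) : closed (pre_annihilator Z).
Proof.
rewrite (_ : pre_annihilator Z = \bigcap_(f in Z) (f @^-1` [set 0])); last first.
  by apply/seteqP; split.
apply: closed_bigI => f _; apply: closed_comp => [x _|].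
  exact: dual_continuous.
apply: accessible_closed_set1; apply: hausdorff_accessible.
exact: norm_hausdorff.
Qed.

Definition pre_annihilator_subspace (Z : set dual) : closedSubspace E :=
  ClosedSubspace (pre_annihilator_submod Z) (@pre_annihilator_closed Z).

End Dual.

Section Quotient.
Variables (K : rcFieldType) (E : normedModType K) (Y : closedSubspace E).

Definition subspace_pred : {pred E} := [in (Y : set E)].

HB.instance Definition _ :=
  GRing.isSubmodClosed.Build _ _ subspace_pred (closed_subspace_submod Y).

Lemma subspace_predE (x : E) : (x \in subspace_pred) = (Y : set E) x :> Prop.
Proof. by rewrite inE. Qed.

Definition quotient_space : Type := Quotient.quot subspace_pred.

HB.instance Definition _ := Choice.on quotient_space.
HB.instance Definition _ := GRing.Zmodule.on quotient_space.
HB.instance Definition _ : EqQuotient E (Quotient.equiv subspace_pred) quotient_space := EqQuotient.on quotient_space.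

Definition quotient_map (x : E) : quotient_space := (\pi_quotient_space x)%qT.

Lemma quotient_mapP (x y : E) : quotient_map x = quotient_map y <-> (Y : set E) (x - y).
Proof.
by rewrite -subspace_predE Quotient.idealrBE; split => /eqP.
Qed.

Lemma quotient_map_surj (u : quotient_space) : exists x, quotient_map x = u.
Proof. by exists (repr u); rewrite /quotient_map reprK. Qed.

Lemma quotient_mapD : {morph quotient_map : x y / x + y}.
Proof. exact: Quotient.pi_add. Qed.

Definition quotient_scale (a : K) (u : quotient_space) : quotient_space :=
  quotient_map (a *: repr u).

Lemma quotient_mapZ (a : K) (x : E) :
  quotient_map (a *: x) = quotient_scale a (quotient_map x).
Proof.
apply/quotient_mapP; rewrite -scalerBr.
have : (Y : set E) (x - repr (quotient_map x)).
  by apply/quotient_mapP; rewrite /quotient_map reprK.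
by rewrite -!subspace_predE => /(rpredZ a).
Qed.

Lemma quotient_scaleA (a b : K) (u : quotient_space) :
  quotient_scale a (quotient_scale b u) = quotient_scale (a * b) u.
Proof.
by have [x <-] := quotient_map_surj u; rewrite -!quotient_mapZ scalerA.
Qed.

Lemma quotient_scale1 : left_id 1 quotient_scale.
Proof.
by move=> u; have [x <-] := quotient_map_surj u; rewrite -quotient_mapZ scale1r.
Qed.

Lemma quotient_scaleDr : right_distributive quotient_scale +%R.
Proof.
move=> a u v; have [x <-] := quotient_map_surj u.
have [y <-] := quotient_map_surj v.
by rewrite -quotient_mapD -!quotient_mapZ scalerDr quotient_mapD.
Qed.

Lemma quotient_scaleDl (u : quotient_space) :
  {morph quotient_scale^~ u : a b / a + b}.
Proof.
move=> a b; have [x <-] := quotient_map_surj u.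
by rewrite -!quotient_mapZ scalerDl quotient_mapD.
Qed.

HB.instance Definition _ := GRing.Zmodule_isLmodule.Build K quotient_space
  quotient_scaleA quotient_scale1 quotient_scaleDr quotient_scaleDl.

Lemma quotient_map_linear : linear quotient_map.
Proof. by move=> a x y; rewrite quotient_mapD quotient_mapZ. Qed.

HB.instance Definition _ :=
  GRing.isLinear.Build K E quotient_space *:%R quotient_map quotient_map_linear.

Definition quotient_norm (u : quotient_space) : K :=
  infimum 0 [set `|x| | x in [set x | quotient_map x = u]].

Lemma quotient_normP (u : quotient_space) :
  infimums [set `|x| | x in [set x | quotient_map x = u]] (quotient_norm u).
Proof.
apply: infimumP.
- by move=> _ [x _ <-]; exact: normr_real.
- by have [x xu] := quotient_map_surj u; exists `|x|, x.
- by exists 0 => _ [x _ <-].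
Qed.

Lemma quotient_norm_le (x : E) : quotient_norm (quotient_map x) <= `|x|.
Proof. by have [lb _] := quotient_normP (quotient_map x); apply: lb; exists x. Qed.

Lemma quotient_norm_ge (u : quotient_space) (M : K) :
  (forall x, quotient_map x = u -> M <= `|x|) -> M <= quotient_norm u.
Proof.
by move=> Mu; have [_ glb] := quotient_normP u; apply: glb => _ [x xu <-]; exact: Mu.
Qed.

Lemma quotient_norm_ge0 (u : quotient_space) : 0 <= quotient_norm u.
Proof. exact: quotient_norm_ge. Qed.

Lemma quotient_normD (u v : quotient_space) :
  quotient_norm (u + v) <= quotient_norm u + quotient_norm v.
Proof.
rewrite -lerBlDr; apply: quotient_norm_ge => x xu.
rewrite lerBlDr -lerBlDl; apply: quotient_norm_ge => y yv.
rewrite lerBlDl -xu -yv -quotient_mapD.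
by rewrite (le_trans (quotient_norm_le _))// ler_normD.
Qed.

Lemma quotient_normZ (a : K) (u : quotient_space) :
  quotient_norm (a *: u) = `|a| * quotient_norm u.
Proof.
have leZ b v : b != 0 -> quotient_norm (b *: v) <= `|b| * quotient_norm v.
  move=> b0; rewrite -ler_pdivrMl ?normr_gt0//; apply: quotient_norm_ge => x <-.
  rewrite ler_pdivrMl ?normr_gt0// -normrZ -linearZ; exact: quotient_norm_le.
have [->|a0] := eqVneq a 0.
  rewrite scale0r normr0 mul0r; apply/eqP; rewrite eq_le quotient_norm_ge0 andbT.
  by rewrite -(linear0 quotient_map) (le_trans (quotient_norm_le _))// normr0.
apply/eqP; rewrite eq_le leZ//= -ler_pdivlMl ?normr_gt0// -normfV.
by have := leZ a^-1 (a *: u); rewrite scalerA mulVf// scale1r; apply; rewrite invr_eq0.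
Qed.

Lemma quotient_norm0_eq0 (u : quotient_space) : quotient_norm u = 0 -> u = 0.
Proof.
have [x <-] := quotient_map_surj u => u0.
rewrite -(linear0 quotient_map); apply/quotient_mapP; rewrite subr0.
apply: (closed_subspace_closed (c := Y)) => B /nbhs_normP[e /= e0 xB].
have : ~ (e <= quotient_norm (quotient_map x)).
  by rewrite u0 => /(lt_le_trans e0); rewrite ltxx.
apply: contra_notP => nYB; apply: quotient_norm_ge => y yx.
have yr : `|y| \is Num.real by exact: normr_real.
rewrite real_leNgt ?(gtr0_real e0)//; apply/negP => ye; apply: nYB.
exists (x - y); split; first exact/quotient_mapP.
by apply: xB; rewrite /ball_/= opprB addrC subrK.
Qed.

HB.instance Definition _ := Lmodule_isNormed.Build K quotient_space
  quotient_normD quotient_normZ quotient_norm0_eq0.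

End Quotient.

Section Conditions.
Variables (K : rcFieldType) (E : normedModType K).

(* N need only be a norm on the subspace X; its values off X are irrelevant. *)
Definition equivalent_norm_on (X : set E) (N : E -> K) : Prop :=
  [/\ forall x y, X x -> X y -> N (x + y) <= N x + N y,
      forall a x, X x -> N (a *: x) = `|a| * N x,
      forall x, X x -> N x = 0 -> x = 0 &
      exists c C : K, [/\ 0 < c, 0 < C &
        forall x, X x -> c * `|x| <= N x <= C * `|x|]].

Definition norming (Z : set (dual E)) (X : set E) : Prop :=
  equivalent_norm_on X (fun x => supremum 0 [set `|f x| | f in ball_in Z]).

Definition total_over (Z : set (dual E)) (X : set E) : Prop :=
  X `&` pre_annihilator Z = [set 0].

(* The restriction of T to X is a linear homeomorphism onto T @` X; only the
   values on T @` X of the inverse S matter. *)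
Definition isomorphic_embedding_on (F : normedModType K) (X : set E)
    (T : {linear E -> F}) : Prop :=
  {within X, continuous T} /\
  exists S : F -> E, {in X, cancel T S} /\ {within T @` X, continuous S}.

Definition subspace_sum (X Y : set E) : set E :=
  [set x + y | x in X & y in Y].

End Conditions.

(* Main.v *)
Require Import Defs.
From HB Require Import structures.
From mathcomp Require Import all_boot all_order all_algebra.
From mathcomp Require Import boolp classical_sets functions reals topology.
From mathcomp Require Import normedtype.
From mathcomp Require Import ssrAC ring.

Set Implicit Arguments.
Unset Strict Implicit.
Unset Printing Implicit Defensive.

Import Order.TTheory GRing.Theory Num.Theory.
Import numFieldNormedType.Exports.
Local Open Scope classical_set_scope.
Local Open Scope ring_scope.

(** Write [Y] for the pre-annihilator of [Z] and [Q] for the quotient map by [Y].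
    Conditions (a), (b) and (c) all say that [Q] is bounded below on [X]: there is
    [c > 0] with [c * `|x| <= `|Q x|] for [x] in [X].

    For (a), the weak-star closure [W] of [Z] is the annihilator of [Y]
    ([weak_star_closureE]), and the supremum of [`|f x|] over the unit ball of the
    annihilator of [Y] is the quotient norm of [x] ([annihilator_ball_sup]).  That
    the supremum is not smaller is the Hahn-Banach theorem for the seminorm
    [`|Q x|] ([hahn_banach_seminorm]).  So the norm on [X] defined by [W] is the quotient
    norm, always dominated by the norm of [E], and the equivalence of the two is
    the lower bound.  For (b), a continuous linear map is an isomorphism onto its
    range exactly when it is bounded below
    ([isomorphic_embedding_bounded_below]).

    For (c), a lower bound makes [Q] injective on [X], that is, [Z] total over
    [X], and makes sequences of [X] that are Cauchy modulo [Y] converge, so that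
    the sum is closed ([bounded_below_closed_sum]).  Conversely, on a closed
    direct sum the projection onto [X] along [Y] is bounded, by the open mapping
    theorem, and its norm bounds that of [x] by the norm of any point of the class
    of [x] ([closed_sum_bounded_below]).

    Finally, if the unit ball of [Z] is weak-star dense in that of [W], the two
    balls have the same suprema ([weak_star_dense_ball_sup]), hence define the
    same norm on [X], so that (a) and (d) agree.

    The scalar field is real or complex in an abstract sense, with norms valued
    in it and compared through its partial order.  The Hahn-Banach theorem and
    the category argument are therefore proved directly in this setting. *)

Lemma submod_setP (R : nzRingType) (V : lmodType R) (M : set V) :
  GRing.submod_closed [in M] ->
  [/\ M 0, forall x y, M x -> M y -> M (x + y) &
    forall a x, M x -> M (a *: x)].
Proof.
move=> [M0 ML]; rewrite inE in M0; split=> // [x y Mx My|a x Mx].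
  by have := ML 1 x y; rewrite !inE scale1r; exact.
by have := ML a x 0; rewrite !inE addr0; exact.
Qed.

(** * The Hahn-Banach theorem *)

Section HahnBanach.
Variables (K : rcFieldType) (E : lmodType K).

Definition sublinear (p : E -> K) : Prop :=
  [/\ forall x, p x \is Num.real,
      forall x y, p (x + y) <= p x + p y &
      forall t x, 0 <= t -> p (t *: x) <= t * p x].

Lemma sublinear0 p : sublinear p -> p 0 = 0.
Proof.
case=> _ pD pZ; apply/eqP; rewrite eq_le; apply/andP; split.
  by have := pZ 0 0 (lexx 0); rewrite scaler0 mul0r.
by have := pD 0 0; rewrite addr0 lerDl.
Qed.

Lemma sublinearZ p t x : sublinear p -> 0 <= t -> p (t *: x) = t * p x.
Proof.
move=> ps t0; have [_ pD pZ] := ps; apply/eqP; rewrite eq_le pZ//=.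
have [->|tn0] := eqVneq t 0; first by rewrite mul0r scale0r (sublinear0 ps).
have tgt0 : 0 < t by rewrite lt_def tn0.
rewrite -ler_pdivlMl//.
have := pZ t^-1 (t *: x); rewrite scalerA mulVf// scale1r; apply.
by rewrite invr_ge0.
Qed.

Lemma sublinear_opp p x : sublinear p -> - p (- x) <= p x.
Proof.
move=> ps; have [_ pD _] := ps.
by rewrite lerNl -subr_ge0 opprK -(sublinear0 ps) -(subrr x) addrC pD.
Qed.

(** Infima of families of sublinear functions need not be subadditive, but they
    are when the family is directed in the weak sense that the required
    inequality for the index pair [i], [j] holds with some third index [k].
    Both uses below are of this kind: the decreasing chains of Zorn's lemma, and
    the one-parameter family that defines the tilt.  The minorant [b] makes the
    infimum exist. *)
Lemma sublinear_inf (I : Type) (i0 : I) (P : I -> Prop) (F : I -> E -> K)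
    (b : E -> K) :
  P i0 ->
  (forall i x, P i -> F i x \is Num.real) ->
  (forall i x, P i -> b x <= F i x) ->
  (forall i j x y, P i -> P j ->
    exists2 k, P k & F k (x + y) <= F i x + F j y) ->
  (forall i t x, P i -> 0 <= t ->
    exists2 k, P k & F k (t *: x) <= t * F i x) ->
  exists2 q, sublinear q & forall i x, P i -> q x <= F i x.
Proof.
move=> Pi0 Fr Fb FD FZ.
pose q x := infimum 0 [set F i x | i in P].
have qP x : infimums [set F i x | i in P] (q x).
  apply: infimumP.
  - by move=> _ [i Pi <-]; exact: Fr.
  - by exists (F i0 x), i0.
  - by exists (b x) => _ [i Pi <-]; exact: Fb.
have qF i x : P i -> q x <= F i x by move=> Pi; apply: (qP x).1; exists i.
have qg x m : (forall i, P i -> m <= F i x) -> m <= q x.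
  by move=> mF; apply: (qP x).2 => _ [i Pi <-]; exact: mF.
exists q => //; split.
- by move=> x; rewrite (ler_real (qF i0 x Pi0)) Fr.
- move=> x y; rewrite -lerBlDr; apply: (qg) => i Pi.
  rewrite lerBlDr -lerBlDl; apply: qg => j Pj; rewrite lerBlDl.
  by have [k Pk] := FD i j x y Pi Pj; apply: le_trans; exact: qF.
- move=> t x t0; have [->|tn0] := eqVneq t 0.
    rewrite mul0r; have [k Pk] := FZ i0 0 x Pi0 (lexx 0).
    by rewrite mul0r; apply: le_trans; exact: qF.
  have tgt0 : 0 < t by rewrite lt_def tn0.
  rewrite -ler_pdivrMl//; apply: qg => i Pi; rewrite ler_pdivrMl//.
  by have [k Pk] := FZ i t x Pi t0; apply: le_trans; exact: qF.
Qed.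

(** The function [inf_(t >= 0) (p (x + t x0) - t p x0)]: a sublinear
    minorant of [p] whose value at [- x0] is forced down to [- p x0].  This is
    how a minimal sublinear function is seen to be odd. *)
Lemma sublinear_tilt p x0 : sublinear p ->
  exists q, [/\ sublinear q, forall x, q x <= p x & q (- x0) <= - p x0].
Proof.
move=> ps; have [pr pD pZ] := ps.
have [|||||q qs qF] := @sublinear_inf K 0 (fun t => 0 <= t)
   (fun t x => p (x + t *: x0) - t * p x0) (fun x => - p (- x)).
- by [].
- by move=> t x t0; rewrite realB// realM// ger0_real.
- move=> t x t0; rewrite lerBrDr addrC lerBlDr -(sublinearZ _ ps)//.
  by apply: le_trans (pD _ _); rewrite addrAC subrr add0r.
- move=> s t x y s0 t0; exists (s + t); first exact: addr_ge0.
  rewrite scalerDl addrACA mulrDl opprD [leRHS]addrACA lerD2r; exact: pD.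
- move=> s t x s0 t0; exists (t * s); first exact: mulr_ge0.
  by rewrite -scalerA -scalerDr (sublinearZ _ ps)// mulrBr mulrA.
exists q; split=> //.
  by move=> x; have := qF 0 x (lexx 0); rewrite scale0r addr0 mul0r subr0.
have := qF 1 (- x0) ler01.
by rewrite scale1r addNr (sublinear0 ps) mul1r sub0r.
Qed.

Lemma sublinear_minimal p : sublinear p ->
  exists q, [/\ sublinear q, forall x, q x <= p x &
    forall r, sublinear r -> (forall x, r x <= q x) -> r = q].
Proof.
move=> ps.
pose T := {q : E -> K | sublinear q /\ forall x, q x <= p x}.
pose R (q r : T) : bool := `[< forall x, sval r x <= sval q x >].
have Ts (q : T) : sublinear (sval q) by case: q => q [].
have [||||[q [qs qp]] qmin] := @Zorn T R.
- by move=> q; apply/asboolP.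
- move=> q r s /asboolP qr /asboolP rs; apply/asboolP => x.
  exact: le_trans (qr x).
- move=> [q qP] [r rP] /asboolP qr /asboolP rq; apply: eq_exist => /=.
  by apply/funext => x; apply/eqP; rewrite eq_le qr rq.
- move=> A Atot.
  have [[a Aa]|A0] := pselect (A !=set0); last first.
    exists (exist _ p (conj ps (fun x => lexx (p x)))) => r Ar.
    by case: A0; exists r.
  have [|||||q qs qF] :=
      @sublinear_inf T a A (fun q => sval q) (fun x => - p (- x)).
  + exact: Aa.
  + by move=> r x _; have [] := Ts r.
  + move=> [q [qs qp]] x _ /=.
    by apply: le_trans (sublinear_opp x qs); rewrite lerN2.
  + move=> r s x y Ar As.
    have [_ rD _] := Ts r; have [_ sD _] := Ts s.
    have [/asboolP rs|/asboolP sr] := Atot r s Ar As.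
      by exists s => //; rewrite (le_trans (sD _ _))// lerD2r.
    by exists r => //; rewrite (le_trans (rD _ _))// lerD2l.
  + by move=> r t x Ar t0; exists r => //; have [_ _] := Ts r; exact.
  have qp x : q x <= p x.
    by apply: (le_trans (qF _ x Aa)); case: (a) => [? []].
  exists (exist _ q (conj qs qp)) => r Ar; apply/asboolP => x; exact: qF.
exists q; split=> // r rs rq.
have rp x : r x <= p x by exact: le_trans (qp x).
have := qmin (exist _ r (conj rs rp)) => /(_ _)/(congr1 sval) /=.
by apply; apply/asboolP.
Qed.

(** A minimal sublinear function coincides with all its tilts, so it is odd; an
    odd sublinear function is additive and real-homogeneous.  Taking a minimal
    function below the tilt of [p] at [x0], instead of below [p], pins its value
    at [x0].  No extension from subspaces is involved. *)
Theorem hahn_banach_real p x0 : sublinear p ->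
  exists q : E -> K, [/\ forall x, q x \is Num.real,
    forall x y, q (x + y) = q x + q y,
    forall t x, t \is Num.real -> q (t *: x) = t * q x,
    forall x, q x <= p x & q x0 = p x0].
Proof.
move=> ps; have [p' [p's p'p p'x0]] := sublinear_tilt x0 ps.
have [q [qs qp' qmin]] := sublinear_minimal p's.
have [qr qD qZ] := qs.
have qN x : q (- x) = - q x.
  have [r [rs rq rx]] := sublinear_tilt x qs.
  move: rx; rewrite (qmin r rs rq) => qx.
  apply/eqP; rewrite eq_le qx /=.
  by have := sublinear_opp (- x) qs; rewrite opprK.
exists q; split=> //.
- move=> x y; apply/eqP; rewrite eq_le qD/=.
  by rewrite -lerN2 -qN !opprD (le_trans (qD _ _))// !qN.
- move=> t x tr; have [t0|t0] := real_ge0P tr; first exact: sublinearZ.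
  rewrite -[t]opprK scaleNr qN sublinearZ// ?mulNr//.
  by rewrite oppr_ge0 ltW.
- by move=> x; exact: le_trans (p'p x).
- apply/eqP; rewrite eq_le (le_trans (qp' _))//=.
  by rewrite -lerN2 -qN (le_trans (qp' _)).
Qed.

End HahnBanach.

Section HahnBanachScalar.
Variables (K : rcFieldType).

Lemma imaginary_unit_nonreal (i : K) : i ^+ 2 = -1 -> i \isn't Num.real.
Proof.
move=> i2; apply/negP => /real_exprn_even_ge0 - /(_ 2 isT).
by rewrite i2 oppr_ge0 ler10.
Qed.

Lemma re_unique (i x y x' : K) : i ^+ 2 = -1 ->
  x \is Num.real -> y \is Num.real -> x' \is Num.real ->
  x + i * y = x' -> x = x'.
Proof.
move=> i2 xr yr x'r xy; have [y0|y0] := eqVneq y 0.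
  by move: xy; rewrite y0 mulr0 addr0.
case/negP: (imaginary_unit_nonreal i2); have -> : i = (x' - x) / y.
  by rewrite -xy addrC addKr mulfK.
by rewrite realM ?realV// realB.
Qed.

Variable E : lmodType K.

(** Over complex scalars, a real-linear [q] is the real part of the linear form
    [x |-> q x - i q (i x)], and multiplying [x] by a scalar of modulus one that
    makes the value of the form real and nonnegative turns the bound on [q] into
    a bound on the modulus of the form. *)
Theorem hahn_banach_seminorm (p : E -> K) (x0 : E) :
  (forall x y, p (x + y) <= p x + p y) ->
  (forall a x, p (a *: x) = `|a| * p x) ->
  exists f : E -> K^o, [/\ linear f, forall x, `|f x| <= p x & p x0 <= `|f x0|].
Proof.
move=> pD pZ.
have p0 : p 0 = 0 by rewrite -(scale0r 0) pZ normr0 mul0r.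
have pN x : p (- x) = p x by rewrite -scaleN1r pZ normrN1 mul1r.
have p_ge0 x : 0 <= p x.
  have := pD x (- x); rewrite subrr p0 pN -mulr2n.
  by rewrite pmulrn_lge0.
have ps : sublinear p.
  split=> // [x|t x t0]; first by rewrite ger0_real.
  by rewrite pZ ger0_norm.
have [q [qr qD qZ qp qx0]] := hahn_banach_real x0 ps.
have qN x : q (- x) = - q x by rewrite -scaleN1r qZ ?mulN1r// realN real1.
case: (rc_real_or_complex (s := K)) => [Kr|[i [i2 repr]]].
  exists q; split; last by rewrite -qx0 real_ler_norm.
    by move=> a x y; rewrite qD qZ.
  by move=> x; rewrite real_ler_norml// qp lerNl -qN (le_trans (qp _))// pN.
pose f x : K := q x - i * q (i *: x).
have fD x y : f (x + y) = f x + f y.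
  by rewrite /f scalerDr !qD mulrDr opprD addrACA.
have frZ t x : t \is Num.real -> f (t *: x) = t * f x.
  by move=> tr; rewrite /f scalerA [i * t]mulrC -scalerA !(qZ t)// mulrBr mulrCA.
have fiZ x : f (i *: x) = i * f x.
  rewrite /f scalerA -expr2 i2 scaleN1r qN mulrN opprK mulrBr mulrA -expr2 i2.
  by rewrite mulN1r opprK addrC.
have fZ a x : f (a *: x) = a * f x.
  have [s [t [sr tr -> _]]] := repr a.
  by rewrite scalerDl fD mulrDl frZ// -scalerA fiZ frZ// mulrA.
exists f; split.
- by move=> a x y; rewrite fD fZ.
- move=> x; have [->|fx0] := eqVneq (f x) 0; first by rewrite normr0.
  (* The phase that rotates [f x] to its modulus. *)
  pose th := `|f x| / f x.
  have nth : `|th| = 1 by rewrite normf_div normr_id divff ?normr_eq0.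
  have fth : f (th *: x) = `|f x| by rewrite fZ mulfVK.
  have <- : q (th *: x) = `|f x|.
    apply: (re_unique i2 (y := - q (i *: (th *: x)))); rewrite ?realN ?qr ?normr_real//.
    by rewrite mulrN -/(f _) fth.
  by rewrite (le_trans (qp _))// pZ nth mul1r.
- have [s [t [sr tr fst nf]]] := repr (f x0).
  have sq : q x0 - s = 0.
    apply: (re_unique i2 (y := - q (i *: x0) - t)); rewrite ?realB ?realN ?qr//.
    rewrite mulrBr mulrN addrACA -opprD -/(f _) -fst subrr//.
  rewrite -qx0 (subr0_eq sq) -ler_sqr ?nnegrE ?normr_ge0//; last first.
    by rewrite -(subr0_eq sq) qx0.
  by rewrite nf lerDl real_exprn_even_ge0.
Qed.

End HahnBanachScalar.

(** * Weak-star closed subspaces *)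

Section WeakStar.
Variables (K : rcFieldType) (E : normedModType K).
Implicit Types (Z : set (dual E)) (f g : dual E).

Lemma dual_scaleDE (a : K) f g x : (a *: f + g) x = a * f x + g x.
Proof. by []. Qed.

Lemma weak_star_closure_approx Z f x e : weak_star_closure Z f -> 0 < e ->
  exists2 g, Z g & `|f x - g x| < e.
Proof.
move=> Zf e0.
have evalc : continuous (fun g : weak_star E => (g : dual E) x : K^o).
  move=> g; apply: (@continuous_comp _ _ _ (fun g : weak_star E =>
    ((g : dual E) : E -> K^o) : {ptws E -> K^o}) (fun h => h x)).
    exact: initial_continuous.
  exact: proj_continuous.
have [g [Zg gx]] := Zf _ (evalc f _ (nbhsx_ballx (f x : K^o) e e0)).
by exists g => //; move: gx; rewrite /= -ball_normE.
Qed.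

(** The neighbourhoods of [f] in the topology of pointwise convergence are tested
    on finitely many points, so exact interpolation on finite lists is enough. *)
Lemma weak_star_closure_interpolation Z f :
  (forall xs : seq E, exists2 g, Z g & {in xs, g =1 f}) ->
  weak_star_closure Z f.
Proof.
move=> Zf B [_ [[A oA <-] Af AB]].
(* [G] is generated by the sets of elements of [Z] that agree with [f] on a
   finite list; it converges pointwise to [f]. *)
pose G : set_system (E -> K^o) := [set C | exists xs : seq E,
  forall g, Z g -> {in xs, g =1 f} -> C g].
have FG : Filter G.
  split.
  - by exists [::].
  - move=> C D [xs Cxs] [ys Dys]; exists (xs ++ ys) => g Zg gf; split.
      by apply: Cxs => // x xxs; apply: gf; rewrite mem_cat xxs.
    by apply: Dys => // y yys; apply: gf; rewrite mem_cat yys orbT.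
  - by move=> C D CD [xs Cxs]; exists xs => g Zg gf; apply: CD; exact: Cxs.
have /(_ A) [|xs Axs] : {ptws, G --> (f : E -> K^o)}.
  apply/pointwise_cvgP => x C /nbhs_singleton Cfx; exists [:: x] => g Zg gf.
  by rewrite /= gf ?mem_head.
- by rewrite nbhsE; exists A.
have [g Zg gf] := Zf xs; exists g; split=> //; apply: AB; exact: Axs.
Qed.

Lemma sub_weak_star_closure Z : Z `<=` weak_star_closure Z.
Proof. exact: (@subset_closure (weak_star E)). Qed.

(** Induction on the list, with [Z] varying.  If some [g0] in [Z] takes the value
    1 at the head [x], subtract [f x *: g0] from [f] and pass to the elements of
    [Z] that vanish at [x]: a point [y] killed by all of these is moved into the
    pre-annihilator of [Z] by subtracting [g0 y *: x].  Otherwise [x] itself is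
    in the pre-annihilator, and it imposes no condition. *)
Lemma pre_annihilator_interpolation Z f (xs : seq E) :
  GRing.submod_closed [in Z] ->
  (forall y, pre_annihilator Z y -> f y = 0) ->
  exists2 g, Z g & {in xs, g =1 f}.
Proof.
elim: xs Z f => [|x xs IH] Z f Zs fZ; have [Z0 ZD ZZ] := submod_setP Zs.
  by exists 0.
have ZP a g h : Z g -> Z h -> Z (a *: g + h).
  by move=> Zg Zh; apply: (ZD) => //; exact: ZZ.
have [[g0 [Zg0 g0x]]|Zx0] := pselect (exists g, Z g /\ g x = 1).
- pose Z' := [set g | Z g /\ g x = 0].
  have subm : GRing.submod_closed [in Z'].
    split; first by rewrite inE; split.
    move=> a g h; rewrite !inE => -[Zg gx] [Zh hx]; split; first exact: ZP.
    by rewrite dual_scaleDE gx hx mulr0 addr0.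
  have [|g [Zg gx] gf] := IH Z' (- f x *: g0 + f) subm.
    move=> y Z'y; rewrite dual_scaleDE.
    suff : f (y - g0 y *: x) = 0.
      rewrite linearB linearZ /= => /subr0_eq ->.
      by rewrite mulNr mulrC; exact: addNr.
    apply: fZ => g Zg; have : (- g x *: g0 + g) y = 0.
      apply: Z'y; split; first exact: ZP.
      rewrite dual_scaleDE g0x mulr1 addNr//.
    rewrite dual_scaleDE => gy.
    by rewrite linearB linearZ /= -[RHS]gy addrC mulNr mulrC.
  exists (f x *: g0 + g); first exact: ZP.
  move=> y; rewrite inE => /orP[/eqP ->|yxs].
    by rewrite dual_scaleDE g0x gx mulr1 addr0.
  rewrite dual_scaleDE gf//.
  by rewrite dual_scaleDE mulNr addNKr.
- have Zx : pre_annihilator Z x.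
    move=> g Zg; apply: contra_notP Zx0 => /eqP gx.
    exists ((g x)^-1 *: g + 0); split; first exact: ZP.
    by rewrite dual_scaleDE mulVf//; exact: addr0.
  have [g Zg gf] := IH Z f Zs fZ.
  exists g => // y; rewrite inE => /orP[/eqP ->|]; last exact: gf.
  by rewrite fZ// Zx.
Qed.

(** The bipolar theorem for subspaces.  It needs no separation theorem: a
    functional that vanishes on the pre-annihilator is interpolated exactly by
    elements of [Z] on every finite list. *)
Lemma weak_star_closureE Z : GRing.submod_closed [in Z] ->
  weak_star_closure Z = [set f | forall y, pre_annihilator Z y -> f y = 0].
Proof.
move=> Zs; apply/seteqP; split=> [f Zf y Zy|f fZ]; last first.
  apply: weak_star_closure_interpolation => xs.
  exact: pre_annihilator_interpolation.
apply/eqP; apply: contraT; rewrite -normr_gt0.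
move=> /(weak_star_closure_approx y Zf)[g Zg].
by rewrite (Zy g Zg) subr0 ltxx.
Qed.

End WeakStar.

(** * Quotient norms and norming subspaces *)

Lemma quotient_map_eq0 (K : rcFieldType) (E : normedModType K)
    (Y : closedSubspace E) (y : E) : quotient_map Y y = 0 <-> (Y : set E) y.
Proof.
by rewrite -(linear0 (quotient_map Y)) quotient_mapP subr0.
Qed.

Section Duality.
Variables (K : rcFieldType) (E : normedModType K).

Lemma supremum_eq (A : set K) (a m : K) : A a -> supremums A m ->
  supremum 0 A = m.
Proof.
move=> Aa sm; rewrite /supremum; case: ifPn => [/eqP A0|_].
  by move: Aa; rewrite A0.
case: xgetP => [s -> [us ls]|/(_ m)//]; have [um lm] := sm.
by apply/eqP; rewrite eq_le ls// lm.
Qed.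

Lemma dual_of_contraction (f : E -> K^o) : linear f ->
  (forall x, `|f x| <= `|x|) ->
  exists2 g : dual E, `|g| <= 1 & forall x, g x = f x.
Proof.
move=> lf f1.
have fP : f \in @functional_pred K E.
  apply/asboolP; split=> // x; apply/cvgrPdist_lt => e e0.
  apply/nbhs_normP; exists e => //= y xy.
  have fB : f x - f y = f (x - y).
    by rewrite addrC -scaleN1r -lf scaleN1r addrC.
  by rewrite fB; exact: le_lt_trans xy.
exists (Dual fP) => //; apply: dual_norm_le => x x1.
exact: le_trans (f1 x) x1.
Qed.

(** The seminorm dominating the functional is the distance to [Y]: it is at most
    the norm, whence the bound on [f], and it vanishes on [Y]. *)
Lemma quotient_norm_functional (Y : closedSubspace E) (x0 : E) :
  exists f : dual E, [/\ `|f| <= 1, forall y, (Y : set E) y -> f y = 0 &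
    `|quotient_map Y x0| <= `|f x0|].
Proof.
have [||f [lf fp fx0]] :=
  @hahn_banach_seminorm K E (fun x => `|quotient_map Y x|) x0.
- by move=> x y; rewrite linearD ler_normD.
- by move=> a x; rewrite linearZ normrZ.
have [|g g1 gf] := dual_of_contraction lf.
  by move=> x; rewrite (le_trans (fp x))//; exact: quotient_norm_le.
exists g; split=> //; last by rewrite gf.
move=> y Yy; rewrite gf; apply/eqP; rewrite -normr_le0 (le_trans (fp y))//.
by rewrite ((quotient_map_eq0 Y y).2 Yy) normr0.
Qed.

(** The duality between the annihilator of [Y] and the quotient by [Y].  It makes
    the norm in the definition of a norming set explicit: for the weak-star
    closure of [Z] it is the quotient norm modulo the pre-annihilator of [Z]. *)
Lemma annihilator_ball_sup (Y : closedSubspace E) (W : set (dual E)) (x : E) :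
  W = [set f | forall y, (Y : set E) y -> f y = 0] ->
  supremum 0 [set `|f x| | f in ball_in W] = `|quotient_map Y x|.
Proof.
move=> WE; have [f [f1 fY fx]] := quotient_norm_functional Y x.
have Wf : ball_in W f by split=> //; rewrite WE.
apply: (@supremum_eq _ `|f x|); first by exists f.
split=> [_ [g [Wg g1] <-]|M /(_ `|f x|) fM].
  apply: quotient_norm_ge => z /quotient_mapP zx; rewrite WE in Wg.
  have <- : g z = g x by apply/subr0_eq; rewrite -linearB; exact: Wg.
  rewrite (le_trans (dual_norm_ge g z))// ler_piMl//.
by apply: (le_trans fx); apply: fM; exists f.
Qed.

(** The common quantitative form of the conditions on the restriction of the
    quotient map. *)
Definition bounded_below_on (F : normedModType K) (X : set E) (T : E -> F) :=
  exists2 c : K, 0 < c & forall x, X x -> c * `|x| <= `|T x|.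

Lemma equivalent_norm_quotient (X : set E) (Y : closedSubspace E) :
  equivalent_norm_on X (fun x => `|quotient_map Y x|) <->
  bounded_below_on X (quotient_map Y).
Proof.
split=> [[_ _ _ [c [C [c0 _ cC]]]]|[c c0 cX]].
  by exists c => // x /cC/andP[].
split.
- by move=> x y _ _; rewrite linearD ler_normD.
- by move=> a x _; rewrite linearZ normrZ.
- move=> x Xx Qx0; apply/eqP; rewrite -normr_le0 -(pmulr_rle0 _ c0).
  by rewrite -Qx0 cX.
- exists c, 1; split=> // x Xx; rewrite cX// mul1r; exact: quotient_norm_le.
Qed.

(** Continuity of the inverse at the origin gives the lower bound by scaling;
    conversely the lower bound makes the inverse Lipschitz on the range. *)
Lemma isomorphic_embedding_bounded_below (F : normedModType K)
    (X : set E) (T : {linear E -> F}) :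
  GRing.submod_closed [in X] -> continuous T ->
  isomorphic_embedding_on X T <-> bounded_below_on X T.
Proof.
move=> Xs cT; have [X0 XD XZ] := submod_setP Xs.
have XB x y : X x -> X y -> X (x - y).
  by move=> Xx Xy; rewrite -scaleN1r; apply: XD => //; exact: XZ.
split=> [[_ [S [TS]]]|[c c0 cX]].
  move=> /subspace_continuousP/(_ 0).
  have S0 : S 0 = 0 by rewrite -(linear0 T) TS// inE.
  move=> /(_ _)/cvgrPdist_lt/(_ 1 ltr01) => /(_ _)/nbhs_normP[].
    by exists 0 => //; exact: linear0.
  move=> d /= d0 dS.
  have Tlt x : X x -> `|T x| < d -> `|x| < 1.
    move=> Xx Txd; have := dS (T x); rewrite /ball_/= /from_subspace.
    rewrite sub0r normrN S0 sub0r normrN.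
    by rewrite TS ?inE//; apply => //; exists x.
  exists d => // x Xx; have [->|x0] := eqVneq x 0.
    by rewrite normr0 mulr0.
  have nx0 : 0 < `|x| by rewrite normr_gt0.
  rewrite real_leNgt ?realM ?normr_real ?gtr0_real//; apply/negP => Txd.
  have := Tlt (`|x|^-1 *: x) (XZ _ _ Xx).
  rewrite linearZ !normrZ normfV normr_id mulVf ?gt_eqF// ltxx mulrC.
  by rewrite ltr_pdivrMr// => /(_ Txd).
split; first exact: continuous_subspaceT.
have Tinj x y : X x -> X y -> T x = T y -> x = y.
  move=> Xx Xy Txy; apply/subr0_eq/eqP; rewrite -normr_le0 -(pmulr_rle0 _ c0).
  by rewrite (le_trans (cX _ (XB _ _ Xx Xy)))// linearB Txy subrr normr0.
pose S u := xget 0 [set x | X x /\ T x = u].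
have SP x : X x -> S (T x) = x.
  by move=> Xx; rewrite /S; case: xgetP => [y _ [Xy /Tinj->]//|/(_ x)/=[]].
exists S; split; first by move=> x; rewrite inE; exact: SP.
apply/subspace_continuousP => _ [x Xx <-]; rewrite /from_subspace SP//.
apply/cvgrPdist_lt => e e0; apply/nbhs_normP; exists (c * e).
  by rewrite /= mulr_gt0.
move=> t /= + [y Xy yt]; rewrite -yt SP// -linearB => Txy.
by rewrite -(ltr_pM2l c0) (le_lt_trans _ Txy)// cX//; exact: XB.
Qed.

Lemma quotient_map_continuous (Y : closedSubspace E) :
  continuous (quotient_map Y).
Proof.
move=> x; apply/cvgrPdist_lt => e e0; apply/nbhs_normP; exists e => //= y xy.
by rewrite -linearB; apply: le_lt_trans xy; exact: quotient_norm_le.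
Qed.

(** Evaluation at [x] is weak-star continuous, so its supremum over a set is its
    supremum over any weak-star dense subset. *)
Lemma weak_star_dense_ball_sup (Z : set (dual E)) (x : E) :
  Z 0 ->
  ball_in (weak_star_closure Z) `<=` weak_star_closure (ball_in Z) ->
  supremum 0 [set `|f x| | f in ball_in Z] =
  supremum 0 [set `|f x| | f in ball_in (weak_star_closure Z)].
Proof.
move=> Z0 BZ; set A := [set _ | f in ball_in Z].
have A0 : A `|(0 : dual E) x| by exists 0 => //; split=> //=; rewrite normr0.
have As : supremums A (supremum 0 A).
  apply: supremumP; first by move=> _ [f _ <-]; exact: normr_real.
    by exists `|(0 : dual E) x|.
  exists `|x| => _ [f [_ f1] <-].
  by rewrite (le_trans (dual_norm_ge f x))// ler_piMl.
have [Aub Alub] := As.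
apply/esym/(@supremum_eq _ `|(0 : dual E) x|).
  exists 0 => //; split; last by rewrite /= normr0.
  exact: sub_weak_star_closure.
split=> [_ [f /BZ Zf <-]|M ZM]; last first.
  apply: Alub => _ [f [Zf f1] <-]; apply: ZM; exists f => //; split=> //.
  exact: sub_weak_star_closure.
have sr : supremum 0 A \is Num.real.
  by rewrite ger0_real// (le_trans _ (Aub _ A0)).
rewrite real_leNgt ?normr_real//; apply/negP; rewrite -subr_gt0 => e0.
have [g Zg fg] := weak_star_closure_approx x Zf e0.
have gs : `|g x| <= supremum 0 A by apply: Aub; exists g.
suff : `|f x| < `|f x| by rewrite ltxx.
rewrite -{1}(subrK (g x) (f x)) (le_lt_trans (ler_normD _ _))//.
by rewrite -ltrBrDr (lt_le_trans fg)// lerB.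
Qed.

End Duality.

(** * Completeness and a category argument *)

Section Completeness.
Variable K : rcFieldType.
Implicit Types (C e r : K) (n : nat).

Local Notation half n := ((2^-1 : K) ^+ n).

Lemma halfpow_gt0 n : 0 < half n.
Proof. by rewrite exprn_gt0// invr_gt0 ltr0n. Qed.

Lemma halfpowS n : half n.+1 + half n.+1 = half n.
Proof. by rewrite exprSr -splitr. Qed.

(** The scalars are archimedean because their real elements are conditionally
    complete: a bound of all [e * 2 ^+ n] could be halved. *)
Lemma halfpow_small C e : 0 <= C -> 0 < e -> exists n, C * half n < e.
Proof.
move=> C0 e0; apply: contrapT => /forallNP nex.
have Ce n : e * 2 ^+ n <= C.
  have := nex n; move/negP; rewrite -real_leNgt ?(gtr0_real e0)//; last first.
    by rewrite realM ?ger0_real// ltW// halfpow_gt0.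
  by rewrite exprVn ler_pdivlMr// exprn_gt0// ltr0n.
have [||| s [us ls]] := @rc_lub K [set e * 2 ^+ n | n in [set: nat]].
- by move=> _ [n _ <-]; rewrite /= gtr0_real// mulr_gt0// exprn_gt0// ltr0n.
- by exists (e * 2 ^+ 0), 0.
- by exists C => _ [n _ <-].
have es : e <= s by rewrite -[e]mulr1; apply: us; exists 0.
have : s <= s / 2.
  apply: ls => _ [n _ <-]; rewrite ler_pdivlMr ?ltr0n// -mulrA -exprSr.
  by apply: us; exists n.+1.
rewrite ler_pdivlMr ?ltr0n// mulr_natr mulr2n gerDl => s0.
by have := lt_le_trans e0 (le_trans es s0); rewrite ltxx.
Qed.

Lemma le_halfpow_le C r s : 0 <= C -> r \is Num.real -> s \is Num.real ->
  (forall n, r <= s + C * half n) -> r <= s.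
Proof.
move=> C0 rr sr rC; rewrite real_leNgt//; apply/negP; rewrite -subr_gt0.
move=> /(halfpow_small C0)[n]; rewrite ltrBrDl => sr'.
by have := lt_le_trans sr' (rC n); rewrite ltxx.
Qed.

Lemma real_lower_bound r s : 0 < r -> 0 < s -> exists t, [/\ 0 < t, t <= r & t <= s].
Proof.
move=> r0 s0; have [rs|sr] := real_leP (gtr0_real r0) (gtr0_real s0).
  by exists r.
by exists s; split=> //; exact: ltW.
Qed.

Variable E : completeNormedModType K.
Implicit Types (u : nat -> E).

Lemma geometric_dist u (a : K) n k :
  (forall n, `|u n.+1 - u n| <= a * half n) -> `|u (n + k)%N - u n| <= 2 * a * half n.
Proof.
move=> ua; have a0 : 0 <= a by have := le_trans (normr_ge0 _) (ua 0); rewrite mulr1.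
have : `|u (n + k)%N - u n| <= 2 * a * half n - 2 * a * half (n + k).
  elim: k => [|k IH]; first by rewrite addn0 !subrr normr0.
  rewrite addnS -(subrK (u (n + k)%N) (u _.+1)) -addrA.
  rewrite (le_trans (ler_normD _ _))// (le_trans (lerD (ua _) IH))//.
  rewrite le_eqVlt; apply/orP; left; apply/eqP.
  by rewrite -(halfpowS (n + k)); ring.
move=> /le_trans; apply; rewrite gerBl mulr_ge0 ?mulr_ge0//.
exact/ltW/halfpow_gt0.
Qed.

Lemma geometric_cvg u (a : K) : (forall n, `|u n.+1 - u n| <= a * half n) ->
  exists l, forall n, `|l - u n| <= 2 * a * half n.
Proof.
move=> ua; have a0 : 0 <= a by have := le_trans (normr_ge0 _) (ua 0); rewrite mulr1.
have /cauchy_cvg/cvg_ex[l ul] : cauchy (u @ \oo).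
  apply: cauchy_exP => e e0.
  have [n ne] := halfpow_small (mulr_ge0 (ler0n K 2) a0) e0.
  exists (u n), n => // m /= nm; rewrite -ball_normE /= distrC.
  by rewrite -(subnKC nm); apply: le_lt_trans ne; exact: geometric_dist.
exists l => n; apply: (@le_halfpow_le 1); rewrite ?normr_real//.
  by apply: ger0_real; rewrite !mulr_ge0// ltW// halfpow_gt0.
move=> k; have /cvgrPdist_lt/(_ _ (halfpow_gt0 k))[m _ mu] := ul.
rewrite mul1r -(subrK (u (n + m)%N) l) -addrA addrC.
rewrite (le_trans (ler_normD _ _))// lerD ?geometric_dist// ltW//.
by apply: mu => /=; rewrite leq_addl.
Qed.

Lemma closed_approx (C : set E) (l : E) (a : K) : closed C -> 0 <= a ->
  (forall n, exists2 y, C y & `|l - y| <= a * half n) -> C l.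
Proof.
move=> cC a0 la; apply: cC => B /nbhs_normP[e /= e0 lB].
have [n ne] := halfpow_small a0 e0; have [y Cy ly] := la n.
by exists y; split=> //; apply: lB; exact: le_lt_trans ne.
Qed.

(** For a set [A] closed under half-differences, this amounts to [A] being nowhere
    dense in [M]. *)
Definition closure_contains_no_ball (M A : set E) := forall r : K, 0 < r ->
  exists m, [/\ M m, `|m| <= r &
    exists2 e, 0 < e & forall a, A a -> ~ `|m - a| <= e].

(** Every ball of [M] contains a smaller one that avoids the dilate [(n + 1) A].
    With [m] small and far from [A], one of [x + (n + 1) m] and [x - (n + 1) m]
    is far from the dilate: if both were close to it, the half-difference [m] of
    the rescaled points would be close to a half-difference of elements of [A]. *)
Lemma avoid_dilate (M A : set E) n x (r : K) : GRing.submod_closed [in M] ->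
  (forall x y, A x -> A y -> A (2^-1 *: (x - y))) ->
  closure_contains_no_ball M A -> M x -> 0 < r ->
  exists q : E * K, [/\ M q.1, 0 < q.2, `|q.1 - x| <= r / 2, q.2 <= r / 2 &
    forall a, A a -> ~ `|q.1 - n.+1%:R *: a| <= q.2].
Proof.
move=> /submod_setP[M0 MD MZ] Amid nb Mx r0; set N : K := n.+1%:R.
have N0 : 0 < N by rewrite ltr0n.
have r20 : 0 < r / 2 by rewrite divr_gt0.
have [m [Mm mr [e e0 Am]]] := nb (r / 2 / N) (divr_gt0 r20 N0).
have Nm : `|N *: m| <= r / 2.
  by rewrite normrZ (gtr0_norm N0) mulrC -ler_pdivlMr.
have [t [t0 tN tr]] := real_lower_bound (mulr_gt0 N0 e0) r20.
have [[a Aa xa]|na] := pselect (exists2 a, A a & `|x + N *: m - N *: a| <= t); last first.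
  exists (x + N *: m, t); split=> //=; first exact/MD/MZ.
    by rewrite addrAC subrr add0r.
  by move=> a Aa xa; apply: na; exists a.
exists (x - N *: m, t); split=> //=.
- by apply: MD => //; rewrite -scaleN1r; do 2 apply: (MZ).
- by rewrite addrAC subrr add0r normrN.
move=> b Ab xb; apply: (Am _ (Amid _ _ Aa Ab)).
have twoN : 0 < 2 * N by rewrite mulr_gt0.
rewrite -(ler_pM2l twoN) -[X in X * `|_|](gtr0_norm twoN) -normrZ.
have -> : (2 * N) *: (m - 2^-1 *: (a - b)) =
    (x + N *: m - N *: a) - (x - N *: m - N *: b).
  rewrite scalerBr scalerA {2}[2 * N]mulrC mulfK ?pnatr_eq0// -scalerA scalerBr.
  rewrite scaler_nat mulr2n !opprB !addrA.
  by rewrite [RHS](ACl (1*6*2*5*4*3))/= subrr add0r.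
rewrite (le_trans (ler_normB _ _))// (le_trans (lerD xa xb))//.
by rewrite -mulrA mulr_natl mulr2n lerD.
Qed.

(** The Baire category argument behind the open mapping theorem, for one set [A]
    whose multiples cover [M].  Otherwise there are nested balls, the one chosen
    at step [n] avoiding [(n + 1) A], and the limit of their centres lies in no multiple of [A]. *)
Lemma absorbing_closure_ball (M A : set E) :
  GRing.submod_closed [in M] -> closed M ->
  (forall x y, A x -> A y -> A (2^-1 *: (x - y))) ->
  (forall x, M x -> exists n, A (n.+1%:R^-1 *: x)) ->
  exists2 r, 0 < r &
  forall m, M m -> `|m| <= r -> forall e, 0 < e -> exists2 a, A a & `|m - a| <= e.
Proof.
move=> Ms Mc Amid Aabs; have [M0 _ _] := submod_setP Ms.
apply: contrapT => nr.
have nb : closure_contains_no_ball M A.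
  move=> r r0; apply: contrapT => nm; apply: nr; exists r => // m Mm mr e e0.
  apply: contrapT => na; apply: nm; exists m; split=> //; exists e => // a Aa ma.
  by apply: na; exists a.
(* A pair consists of the centre and the radius of a ball. *)
pose next (np : nat * (E * K)) (q : E * K) := M np.2.1 -> 0 < np.2.2 ->
  [/\ M q.1, 0 < q.2, `|q.1 - np.2.1| <= np.2.2 / 2, q.2 <= np.2.2 / 2 &
     forall a, A a -> ~ `|q.1 - np.1.+1%:R *: a| <= q.2].
have /choice[g gP] : forall np, exists q, next np q.
  move=> [n [x r]]; have [[Mx r0]|n0] := pselect (M x /\ 0 < r).
    by have [q qP] := avoid_dilate n Ms Amid nb Mx r0; exists q.
  by exists (0, 0) => Mx r0; case: n0.
pose s n := iteri n (fun n p => g (n, p)) (0, 1).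
have sP n : M (s n).1 /\ 0 < (s n).2.
  by elim: n => [|n [Mx r0]] //=; have [] := gP (n, s n) Mx r0.
have sS n : [/\ `|(s n.+1).1 - (s n).1| <= (s n).2 / 2,
     (s n.+1).2 <= (s n).2 / 2 &
     forall a, A a -> ~ `|(s n.+1).1 - n.+1%:R *: a| <= (s n.+1).2].
  by have [Mx r0] := sP n; have [] := gP (n, s n) Mx r0.
have rk n k : (s (n + k)%N).2 <= (s n).2 * half k.
  elim: k => [|k IH]; first by rewrite addn0 mulr1.
  rewrite addnS; have [_ + _] := sS (n + k)%N; move=> /le_trans; apply.
  by rewrite exprSr mulrA ler_wpM2r// invr_ge0.
have dk n k : `|(s (n + k.+1)%N).1 - (s (n + k)%N).1| <= (s n).2 / 2 * half k.
  rewrite addnS; have [+ _ _] := sS (n + k)%N; move=> /le_trans; apply.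
  by rewrite mulrAC ler_wpM2r// invr_ge0.
have [l ls] : exists l, forall n, `|l - (s n).1| <= half n.
  have [l ls] := geometric_cvg (dk 0); exists l => n.
  by rewrite (le_trans (ls n))// mulrA /= mulr1 divff ?mul1r// pnatr_eq0.
(* The limit stays in the [n]-th ball because the radii are at least halved and
   each centre moves by at most half of the previous radius. *)
have ln n : `|l - (s n).1| <= (s n).2.
  have rn := sP n; apply: (@le_halfpow_le 1); rewrite ?normr_real//.
    exact: gtr0_real rn.2.
  move=> k; rewrite [leRHS]addrC -(subrK (s (n + k)%N).1 l) -addrA.
  rewrite (le_trans (ler_normD _ _))// lerD//.
    rewrite (le_trans (ls (n + k)%N))// mul1r.
    by rewrite ler_wiXn2l// ?invr_ge0// ?invf_le1// ?ler1n// leq_addl.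
  have := @geometric_dist (fun k => (s (n + k)%N).1) _ 0 k (dk n).
  by rewrite add0n addn0 mulr1 mulrC divfK// pnatr_eq0.
have Ml : M l.
  apply: (@closed_approx M l 1) => // n; exists (s n).1; first exact: (sP n).1.
  by rewrite (le_trans (ln n))// mul1r (le_trans (rk 0 n))// mul1r.
have [n An] := Aabs _ Ml; have [_ _ /(_ _ An)] := sS n; apply.
by rewrite scalerA divff ?scale1r ?pnatr_eq0// distrC.
Qed.

End Completeness.

(** * Closed sums of subspaces *)

Section ClosedSum.
Variables (K : rcFieldType) (E : completeNormedModType K).
Implicit Types (X Y : closedSubspace E).

Local Notation half n := ((2^-1 : K) ^+ n).

(** A point [z] in the closure of the sum is approximated modulo [Y] by points of
    [X], which form a Cauchy sequence by the lower bound; the limit lies in [X]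
    and has the same class as [z]. *)
Lemma bounded_below_closed_sum X Y : bounded_below_on X (quotient_map Y) ->
  closed (subspace_sum X Y).
Proof.
move=> [c c0 cX] z zcl.
have [X0 XD XZ] := submod_setP (closed_subspace_submod X).
have : forall n, exists x, (X : set E) x /\
    `|quotient_map Y z - quotient_map Y x| <= half n.
  move=> n.
  have [_ [[x Xx [y Yy <-]]]] := zcl _ (nbhsx_ballx z _ (@halfpow_gt0 K n)).
  rewrite -ball_normE /= => zxy; exists x; split=> //.
  apply: (le_trans _ (ltW zxy)).
  suff -> : quotient_map Y z - quotient_map Y x = quotient_map Y (z - (x + y)).
    exact: quotient_norm_le.
  rewrite -linearB; apply/quotient_mapP.
  by rewrite opprB !addrA subrK addrAC subrr add0r.
move=> /choice[u uP].
have uS n : `|u n.+1 - u n| <= (2 / c) * half n.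
  rewrite mulrAC ler_pdivlMr// mulrC (le_trans (cX _ _))//.
    by rewrite -scaleN1r; apply: XD; [|apply: XZ]; case: (uP n); case: (uP n.+1).
  rewrite linearB /= -(subrK (quotient_map Y z) (quotient_map Y (u n.+1))) -addrA.
  rewrite (le_trans (ler_normD _ _))// mulr_natl mulr2n lerD//; last by case: (uP n).
  rewrite distrC (le_trans (uP _).2)// -[leRHS]halfpowS lerDl; exact/ltW/halfpow_gt0.
have [l lu] := geometric_cvg uS.
have C0 : 0 <= 2 * (2 / c) by rewrite mulr_ge0// divr_ge0// ltW.
have Xl : (X : set E) l.
  apply: (closed_approx (@closed_subspace_closed _ _ X) C0) => n.
  by exists (u n) => //; case: (uP n).
exists l => //; exists (z - l); last by rewrite addrC subrK.
apply/quotient_map_eq0/eqP; rewrite -normr_le0.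
apply: (@le_halfpow_le _ (1 + 2 * (2 / c))); rewrite ?real0 ?normr_real ?addr_ge0//.
move=> n; rewrite add0r linearB /=.
rewrite -(subrK (quotient_map Y (u n)) (quotient_map Y z)) -addrA mulrDl.
rewrite (le_trans (ler_normD _ _))// lerD//; first by rewrite mul1r; case: (uP n).
rewrite distrC -linearB; apply: le_trans (lu n); exact: quotient_norm_le.
Qed.

(** The open mapping theorem for the addition map from [X] times [Y] onto the sum,
    bounding the component in [X].  The set [A] of sums [x + y] with
    [`|x| <= 1] absorbs [X + Y], so its closure contains a ball; correcting the
    error by elements of ever smaller multiples of [A] gives a geometric series
    in [X] of total norm at most 2, while the remainder tends to an element of
    the closed subspace [Y]. *)
Lemma closed_sum_decomposition X Y : closed (subspace_sum X Y) ->
  exists2 r, 0 < r & forall m, subspace_sum X Y m -> `|m| <= r ->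
    exists x, [/\ (X : set E) x, (Y : set E) (m - x) & `|x| <= 2].
Proof.
set M := subspace_sum X Y => Mc.
have [X0 XD XZ] := submod_setP (closed_subspace_submod X).
have [Y0 YD YZ] := submod_setP (closed_subspace_submod Y).
have M0 : M 0 by exists 0 => //; exists 0 => //; rewrite addr0.
have MD x y : M x -> M y -> M (x + y).
  move=> [a Xa [b Yb <-]] [a' Xa' [b' Yb' <-]].
  exists (a + a'); first exact: XD.
  by exists (b + b'); [exact: YD|rewrite addrACA].
have MZ a x : M x -> M (a *: x).
  move=> [b Xb [d Yd <-]]; exists (a *: b); first exact: XZ.
  by exists (a *: d); [exact: YZ|rewrite scalerDr].
pose A := [set x + y | x in (X : set E) `&` [set x | `|x| <= 1] & y in (Y : set E)].
have Ms : GRing.submod_closed [in M].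
  split=> [|a x y]; rewrite !inE // => Mx My.
  by apply: MD => //; exact: MZ.
have Amid x y : A x -> A y -> A (2^-1 *: (x - y)).
  move=> [a [Xa a1] [b Yb <-]] [a' [Xa' a'1] [b' Yb' <-]].
  exists (2^-1 *: (a - a')).
    split; first by rewrite -scaleN1r; apply/XZ/XD => //; exact: XZ.
    rewrite /= normrZ normfV normr_nat ler_pdivrMl// mulr1.
    by rewrite (le_trans (ler_normB _ _))// lerD.
  exists (2^-1 *: (b - b')); first by rewrite -scaleN1r; apply/YZ/YD => //; exact: YZ.
  by rewrite -scalerDr opprD addrACA.
have Aabs x : M x -> exists n, A (n.+1%:R^-1 *: x).
  move=> [a Xa [b Yb <-]].
  have [n nx] := halfpow_small (normr_ge0 a) (@ltr01 K).
  exists (2 ^ n).-1; rewrite prednK ?expn_gt0// natrX -exprVn.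
  exists (half n *: a); last first.
    by exists (half n *: b); [exact: YZ|rewrite scalerDr].
  split; first exact: XZ.
  by rewrite /= normrZ gtr0_norm ?halfpow_gt0// mulrC ltW.
have [r r0 rA] := absorbing_closure_ball Ms Mc Amid Aabs.
exists r => // m Mm mr.
have step n q : M q -> `|q| <= r * half n -> exists x, [/\ (X : set E) x.1,
    (Y : set E) x.2, `|x.1| <= half n & `|q - (x.1 + x.2)| <= r * half n.+1].
  move=> Mq qr; have hn := @halfpow_gt0 K n.
  have [||_ [x [Xx x1] [y Yy <-]] qxy] :=
      rA ((half n)^-1 *: q) _ _ (r / 2) (divr_gt0 r0 (ltr0n _ 2)).
  - exact: MZ.
  - by rewrite normrZ normfV gtr0_norm// mulrC ler_pdivrMr.
  exists (half n *: x, half n *: y); split=> /=; [exact: XZ|exact: YZ| |].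
    by rewrite normrZ gtr0_norm// ger_pMr.
  have -> : q - (half n *: x + half n *: y) = half n *: ((half n)^-1 *: q - (x + y)).
    by rewrite scalerBr scalerA divff ?gt_eqF// scale1r scalerDr.
  by rewrite normrZ gtr0_norm// mulrC exprS mulrA ler_wpM2r// ltW.
(* The pair consists of the partial sums of the components in [X] and [Y]. *)
pose good n (p : E * E) := [/\ (X : set E) p.1, (Y : set E) p.2 &
  `|m - (p.1 + p.2)| <= r * half n].
have /choice[g gP] : forall np : nat * (E * E), exists q, good np.1 np.2 ->
    good np.1.+1 q /\ `|q.1 - np.2.1| <= half np.1.
  move=> [n [x y]] /=; have [[/= Xx Yy xy]|ng] := pselect (good n (x, y)); last first.
    by exists 0.
  have [|[x' y'] /= [Xx' Yy' x'n xy']] := step n (m - (x + y)) _ xy.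
    by apply: MD => //; rewrite -scaleN1r; apply: MZ; exists x => //; exists y.
  exists (x + x', y + y') => _; split; last by rewrite /= addrAC subrr add0r.
  split; [exact: XD|exact: YD|].
  by rewrite /= addrACA opprD addrA.
pose s n := iteri n (fun n p => g (n, p)) (0, 0).
have sP n : good n (s n).
  elim: n => [|n IH]; first by split=> //=; rewrite addr0 subr0 mulr1.
  by have [] := gP (n, s n) IH.
have sS n : `|(s n.+1).1 - (s n).1| <= 1 * half n.
  by rewrite mul1r; have [] := gP (n, s n) (sP n).
have [l ls] : exists l, forall n, `|l - (s n).1| <= 2 * half n.
  by have [l] := geometric_cvg sS; rewrite mulr1; exists l.
exists l; split.
- apply: (@closed_approx _ _ X l 2) => //.
    exact: closed_subspace_closed.
  by move=> n; exists (s n).1; [case: (sP n)|exact: ls].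
- apply: (@closed_approx _ _ Y _ (r + 2)); rewrite ?addr_ge0 ?(ltW r0)//.
    exact: closed_subspace_closed.
  move=> n; have [_ Ysn msn] := sP n; exists (s n).2 => //.
  have -> : m - l - (s n).2 = m - ((s n).1 + (s n).2) - (l - (s n).1).
    by rewrite opprD opprB !addrA [RHS](ACl (1*5*3*(2*4)))/= addNr addr0.
  by rewrite (le_trans (ler_normB _ _))// mulrDl lerD.
- by have := ls 0%N; rewrite /= subr0 mulr1.
Qed.

(** If [z] is congruent to [x] modulo [Y], then [z] is in the sum and, the sum
    being direct, its component in [X] is [x]; the bound on components
    therefore compares the norm of [x] with that of every point in its class. *)
Lemma closed_sum_bounded_below X Y : X `&` Y = [set 0] ->
  closed (subspace_sum X Y) -> bounded_below_on X (quotient_map Y).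
Proof.
move=> XY /closed_sum_decomposition[r r0 rXY].
have [X0 XD XZ] := submod_setP (closed_subspace_submod X).
have [Y0 YD YZ] := submod_setP (closed_subspace_submod Y).
exists (r / 2); first by rewrite divr_gt0.
move=> x Xx; apply: quotient_norm_ge => z /quotient_mapP Yzx.
have XY0 w : (X : set E) w -> (Y : set E) w -> w = 0.
  by move=> Xw Yw; have : (X `&` Y) w by []; rewrite XY.
have [z0|z0] := eqVneq z 0.
  rewrite (XY0 x) ?normr0 ?mulr0//; move: Yzx; rewrite z0 sub0r -scaleN1r.
  by move=> /(YZ (-1)); rewrite scalerA mulrNN mulr1 scale1r.
have nz : 0 < `|z| by rewrite normr_gt0.
pose a := r / `|z|; have a0 : 0 < a by rewrite divr_gt0.
have [||x' [Xx' Yx' x'2]] := rXY (a *: z).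
- exists (a *: x); first exact: XZ.
  by exists (a *: (z - x)); [exact: YZ|rewrite -scalerDr addrC subrK].
- by rewrite normrZ gtr0_norm// divfK ?gt_eqF.
have /subr0_eq ax : a *: x - x' = 0.
  apply: XY0; first by rewrite -scaleN1r; apply: XD; exact: XZ.
  have -> : a *: x - x' = a *: z - x' + (-1) *: (a *: (z - x)).
    by rewrite scaleN1r scalerBr opprB addrCA addrAC subrr add0r.
  by apply: YD => //; do 2 apply: (YZ).
move: x'2; rewrite -ax normrZ gtr0_norm// /a mulrAC ler_pdivrMr//.
by rewrite mulrAC ler_pdivrMr// [_ * 2]mulrC.
Qed.

End ClosedSum.

(** * The equivalences *)

Theorem lemma2 (K : rcFieldType) (E : completeNormedModType K)
    (X : closedSubspace E) (Z : closedSubspace (dual E)) :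
  let a := norming (weak_star_closure Z) X in
  let b := isomorphic_embedding_on X
             (quotient_map (pre_annihilator_subspace Z)) in
  let c := total_over Z X /\ closed (subspace_sum X (pre_annihilator Z)) in
  let d := norming Z X in
  [/\ a <-> b, b <-> c &
      ball_in (weak_star_closure Z) `<=` weak_star_closure (ball_in Z) ->
      a <-> d].
Proof.
set Y := pre_annihilator_subspace Z.
have Zs := closed_subspace_submod Z; have [Z0 _ _] := submod_setP Zs.
have [X0 _ _] := submod_setP (closed_subspace_submod X).
have [Y0 _ _] := submod_setP (closed_subspace_submod Y).
have bE : isomorphic_embedding_on X (quotient_map Y) <->
    bounded_below_on X (quotient_map Y).
  apply: isomorphic_embedding_bounded_below.
    exact: closed_subspace_submod.
  exact: quotient_map_continuous.
move=> a b c d; split.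
- rewrite /a /norming; under eq_fun do
    rewrite (@annihilator_ball_sup _ _ Y _ _ (weak_star_closureE Zs)).
  by rewrite equivalent_norm_quotient; exact: iff_sym.
- apply: (iff_trans bE); split=> [bb|[tot cl]]; last exact: closed_sum_bounded_below.
  split; last exact: (@bounded_below_closed_sum _ _ X Y bb).
  apply/seteqP; split=> [x [Xx Yx]|_ ->//].
  have [c0 c0gt0 /(_ _ Xx)] := bb.
  by rewrite ((quotient_map_eq0 Y x).2 Yx) normr0 pmulr_rle0// normr_le0 => /eqP.
- move=> BZ; rewrite /a /d /norming.
  by under [X in _ <-> equivalent_norm_on _ X]eq_fun do
    rewrite (weak_star_dense_ball_sup _ Z0 BZ).
Qed.
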